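(* Let $\{\varepsilon_1,\varepsilon_2,\varepsilon_3\}=\{\alpha,\beta,\gamma\}$, $\{P_1,P_2,P_3\}=\{A,B,C\}$ and the chain of circles $\mathcal{C}=\{\dots,\delta_{-2},\delta_{-1},\varepsilon_1=\delta_0,\delta_1,\delta_2,\dots\}$ be as in the context. Let $r_n$ be the radius and $D_n$ the center of $\delta_n$. If $D_i$ is the center of the circle $\delta_i\in\mathcal{C}$ and $H_i(n)$ is the point of intersection of the line $P_1D_i$ and the perpendicular to $AB$ from $D_n$, then the following relation holds: $$|D_nH_i(n)| = 2|n-i|\,r_n .$$
   Context: Let $C$ be a point on a segment $AB$ in the Euclidean plane, and let $\alpha$, $\beta$, $\gamma$ be the circles with diameters $BC$, $CA$, $AB$, respectively. Let $\{\varepsilon_1,\varepsilon_2,\varepsilon_3\}=\{\alpha,\beta,\gamma\}$ (in any labelling) and $\{P_1,P_2,P_3\}=\{A,B,C\}$, labelled so that $P_3P_1$ and $P_1P_2$ are diameters of $\varepsilon_2$ and $\varepsilon_3$, respectively. The chain $\mathcal{C}=\{\dots,\delta_{-2},\delta_{-1},\delta_0,\delta_1,\delta_2,\dots\}$ is the two-sided chain of distinct circles, indexed by the integers, with $\delta_0=\varepsilon_1$, whose members all touch the circles $\varepsilon_2$ and $\varepsilon_3$ and in which $\delta_n$ touches $\delta_{n+1}$ for every integer $n$. $|XY|$ denotes the distance between points $X$ and $Y$. *)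

(* Defs.v *)
From Stdlib Require Import Reals ZArith List Permutation.
Open Scope R_scope.

Definition point : Type := (R * R)%type.

Definition edist (X Y : point) : R :=
  dist_euc (fst X) (snd X) (fst Y) (snd Y).

(* The point X + t (Y - X). *)
Definition along (X Y : point) (t : R) : point :=
  (fst X + t * (fst Y - fst X), snd X + t * (snd Y - snd X)).

Definition on_segment (A B X : point) : Prop :=
  exists t : R, 0 <= t <= 1 /\ X = along A B t.

(* The line XY; meaningful only for X <> Y. *)
Definition on_line (X Y Z : point) : Prop :=
  exists t : R, Z = along X Y t.

(* Z lies on the perpendicular to the line AB through D. *)
Definition on_perp (A B D Z : point) : Prop :=
  (fst Z - fst D) * (fst B - fst A) + (snd Z - snd D) * (snd B - snd A) = 0.

(* No proof of [0 < radius] is stored, so that equality of circles is equality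
   of centers and radii; positivity is required separately. *)
Record circle : Type := Circle { center : point; radius : R }.

Definition on_circle (c : circle) (X : point) : Prop :=
  edist (center c) X = radius c.

Definition circle_diam (X Y : point) : circle :=
  Circle (along X Y (1 / 2)) (edist X Y / 2).

(* Internal or external tangency. A circle of positive radius does not touch
   itself. *)
Definition touch (c d : circle) : Prop :=
  exists! X : point, on_circle c X /\ on_circle d X.

Definition chain (e1 e2 e3 : circle) (delta : Z -> circle) : Prop :=
  delta 0%Z = e1 /\
  (forall n : Z, 0 < radius (delta n)) /\
  (forall m n : Z, delta m = delta n -> m = n) /\
  (forall n : Z, touch (delta n) e2 /\ touch (delta n) e3) /\
  (forall n : Z, touch (delta n) (delta (n + 1)%Z)).

(* Main.v *)
Require Import Defs.
From Stdlib Require Import Reals ZArith List Permutation.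
From Stdlib Require Import Lra Lia.
Import ListNotations.
Open Scope R_scope.

(** The circles [e2] and [e3] touch each other at [P1], so an inversion centered
    at [P1] turns them into two parallel lines, perpendicular to [AB]. It turns
    [e1] into a circle touching both lines, and the chain into a row of equal
    circles between the lines, each touching the next. As the circles are
    distinct, the row never turns back: the center of the [n]-th inverted circle
    lies [n * s] above [AB], where [s] is, up to sign, the common diameter of the
    row, the distance of the two lines ([injective_walk]).

    The inverse of a circle with center [D], radius [r] and power
    [w = |P1 D|^2 - r^2] with respect to [P1] has center [D / w] (from [P1] as
    origin) and radius [r / |w|]. Hence [D_n = w_n * (m, n * s)], where [m] is the
    abscissa of the middle line of the strip, and [2 r_n = |w_n s|]
    ([chain_inverse]). The line [P1 D_i] has slope [i * s / m], and so meets the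
    perpendicular through [D_n] at [w_n * (m, i * s)]. Its distance from [D_n] is
    [|w_n s| |n - i| = 2 |n - i| r_n].

    A circle through [P1] inverts to a line and must be kept out of the chain. If
    it touches [e2] and [e3], that line is parallel to the two given lines; if it
    also touches a circle of the row, it is one of the two, so that the circle is
    [e2] or [e3], which does not touch itself ([power_neq0_step]). *)

(** * Tangency as an equation *)

Definition sqdist (X Y : point) : R :=
  (fst X - fst Y) ^ 2 + (snd X - snd Y) ^ 2.

(** The equation says that the squared distance of the centers is
    [(r1 + r2)^2] or [(r1 - r2)^2]. *)
Definition tangent (c d : circle) : Prop :=
  center c <> center d /\
  (sqdist (center c) (center d) - radius c ^ 2 - radius d ^ 2) ^ 2
    = 4 * radius c ^ 2 * radius d ^ 2.

Lemma edist_ge0 (X Y : point) : 0 <= edist X Y.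
Proof. apply sqrt_pos. Qed.

Lemma edist_sqr (X Y : point) : edist X Y ^ 2 = sqdist X Y.
Proof.
unfold edist, dist_euc, sqdist; rewrite pow2_sqrt.
- unfold Rsqr; ring.
- apply Rplus_le_le_0_compat; apply Rle_0_sqr.
Qed.

Lemma sqdist_eq0 (X Y : point) : sqdist X Y = 0 -> X = Y.
Proof.
unfold sqdist; rewrite <- !Rsqr_pow2; intros E.
destruct (Rplus_sqr_eq_0 _ _ E); apply injective_projections; lra.
Qed.

Lemma on_circle_sqdist (c : circle) (X : point) :
  0 < radius c -> (on_circle c X <-> sqdist (center c) X = radius c ^ 2).
Proof.
intros rc; unfold on_circle; rewrite <- edist_sqr; split; intros E.
- now rewrite E.
- pose proof (edist_ge0 (center c) X); nra.
Qed.

(** Reflecting a common point in the line of centers gives a common point, so a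
    unique common point lies on that line. For concentric circles the reflection
    in the center plays this role. *)
Lemma touch_tangent (c d : circle) :
  0 < radius c -> 0 < radius d -> touch c d -> tangent c d.
Proof.
intros rc rd [X [[Xc Xd] uniqX]].
apply on_circle_sqdist in Xc; [|assumption].
apply on_circle_sqdist in Xd; [|assumption].
assert (uniqX' : forall Y, sqdist (center c) Y = radius c ^ 2 ->
                   sqdist (center d) Y = radius d ^ 2 -> X = Y).
{ intros Y Yc Yd; apply uniqX; split; now apply on_circle_sqdist. }
clear uniqX; unfold tangent.
destruct c as [[cx cy] r1]; destruct d as [[dx dy] r2]; destruct X as [X1 X2].
unfold sqdist in *; simpl center in *; simpl radius in *; simpl fst in *;
  simpl snd in *.
assert (neq : (cx, cy) <> (dx, dy)).
{ intros E; injection E as -> ->.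
  assert (F : (X1, X2) = (2 * dx - X1, 2 * dy - X2)).
  { apply uniqX'; simpl; nra. }
  injection F as F1 F2; nra. }
split; [exact neq|].
set (a := dx - cx); set (b := dy - cy).
assert (Dpos : 0 < a ^ 2 + b ^ 2).
{ destruct (Req_dec a 0) as [a0|a0]; [destruct (Req_dec b 0) as [b0|b0]|].
  - exfalso; apply neq; f_equal; unfold a, b in *; lra.
  - nra.
  - nra. }
(* [k] is the signed distance of [X] from the line of centers, divided by the
   distance of the centers; [(- b, a)] is normal to the line. *)
set (k := ((X2 - cy) * a - (X1 - cx) * b) / (a ^ 2 + b ^ 2)).
assert (kE : k * (a ^ 2 + b ^ 2) = (X2 - cy) * a - (X1 - cx) * b).
{ unfold k; field; lra. }
assert (F : (X1, X2) = (X1 + 2 * k * b, X2 - 2 * k * a)).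
{ apply uniqX'; cbn [fst snd].
  - replace (r1 ^ 2) with ((cx - X1) ^ 2 + (cy - X2) ^ 2
      + 4 * k * (k * (a ^ 2 + b ^ 2) - ((X2 - cy) * a - (X1 - cx) * b)))
      by (rewrite kE, Rminus_diag, Xc; ring).
    ring.
  - replace (r2 ^ 2) with ((dx - X1) ^ 2 + (dy - X2) ^ 2
      + 4 * k * (k * (a ^ 2 + b ^ 2) - ((X2 - cy) * a - (X1 - cx) * b)))
      by (rewrite kE, Rminus_diag, Xd; ring).
    unfold a, b; ring. }
injection F as F1 F2.
assert (cross : (X2 - cy) * a - (X1 - cx) * b = 0).
{ rewrite <- kE; replace (k * (a ^ 2 + b ^ 2)) with ((k * a) * a + (k * b) * b)
    by ring.
  replace (k * a) with 0 by lra; replace (k * b) with 0 by lra; ring. }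
(* Lagrange's identity for the vectors from the centers to [X]: their cross
   product vanishes, and their scalar product follows from the law of cosines. *)
rewrite <- Xc, <- Xd.
replace (4 * ((cx - X1) ^ 2 + (cy - X2) ^ 2) * ((dx - X1) ^ 2 + (dy - X2) ^ 2))
  with (4 * ((cx - X1) * (dx - X1) + (cy - X2) * (dy - X2)) ^ 2
        + 4 * ((X2 - cy) * a - (X1 - cx) * b) ^ 2) by (unfold a, b; ring).
rewrite cross; ring.
Qed.

(** * Coordinates with origin [P1] and first axis [AB] *)

(** Coordinates of [X] in the orthonormal frame with origin [O] and first vector
    [u]. *)
Definition coords (O u X : point) : point :=
  ((fst X - fst O) * fst u + (snd X - snd O) * snd u,
   (snd X - snd O) * fst u - (fst X - fst O) * snd u).

Definition in_frame (O u : point) (c : circle) : circle :=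
  Circle (coords O u (center c)) (radius c).

Definition unit_vector (u : point) : Prop := fst u ^ 2 + snd u ^ 2 = 1.

Lemma sqdist_coords (O u X Y : point) :
  unit_vector u -> sqdist (coords O u X) (coords O u Y) = sqdist X Y.
Proof.
unfold unit_vector, sqdist, coords; simpl; intros uE.
transitivity (((fst X - fst Y) ^ 2 + (snd X - snd Y) ^ 2)
              * (fst u ^ 2 + snd u ^ 2)); [ring|].
simpl; rewrite uE; ring.
Qed.

Lemma coords_inj (O u X Y : point) :
  unit_vector u -> coords O u X = coords O u Y -> X = Y.
Proof.
intros uE E; apply sqdist_eq0.
rewrite <- (sqdist_coords O u), E by assumption; unfold sqdist; ring.
Qed.

Lemma in_frame_inj (O u : point) (c d : circle) :
  unit_vector u -> in_frame O u c = in_frame O u d -> c = d.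
Proof.
intros uE E; destruct c as [C r], d as [D s].
injection E as E1 E2 E3; f_equal; [|assumption].
apply (coords_inj O u); [assumption|].
now apply injective_projections.
Qed.

Lemma tangent_in_frame (O u : point) (c d : circle) :
  unit_vector u -> tangent c d -> tangent (in_frame O u c) (in_frame O u d).
Proof.
intros uE [neq E]; split; simpl.
- intros F; apply neq; now apply (coords_inj O u).
- now rewrite sqdist_coords.
Qed.

Lemma coords_along (O u X : point) (t : R) :
  coords O u (along O X t) = (t * fst (coords O u X), t * snd (coords O u X)).
Proof. unfold coords, along; simpl; f_equal; ring. Qed.

(** The circle having the segment from [(p, 0)] to [(q, 0)] as diameter. *)
Definition axis_circle (p q : R) : circle :=
  Circle ((p + q) / 2, 0) (Rabs (p - q) / 2).

Lemma in_frame_circle_diam (O u X Y : point) (p q : R) :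
  unit_vector u -> coords O u X = (p, 0) -> coords O u Y = (q, 0) ->
  in_frame O u (circle_diam X Y) = axis_circle p q.
Proof.
intros uE EX EY; unfold in_frame, axis_circle; simpl; f_equal.
- injection EX as X1 X2; injection EY as Y1 Y2.
  unfold coords, along; simpl; f_equal; nra.
- f_equal; apply Rsqr_inj; [apply edist_ge0 | apply Rabs_pos |].
  rewrite <- Rsqr_abs, !Rsqr_pow2, edist_sqr, <- (sqdist_coords O u) by assumption.
  rewrite EX, EY; unfold sqdist; simpl; ring.
Qed.

(** * Inversion at the origin *)

Definition power (c : circle) : R :=
  fst (center c) ^ 2 + snd (center c) ^ 2 - radius c ^ 2.

(** The center of the inverse circle. *)
Definition inv_x (c : circle) : R := fst (center c) / power c.
Definition inv_y (c : circle) : R := snd (center c) / power c.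

(** The radius of the inverse circle, up to sign. *)
Definition inv_r (c : circle) : R := radius c / power c.

(** Inversion is an involution: the power of the inverse circle is [/ power c]. *)
Lemma power_inverse (c : circle) :
  power c <> 0 -> / power c = inv_x c ^ 2 + inv_y c ^ 2 - inv_r c ^ 2.
Proof.
intros w0.
transitivity ((fst (center c) ^ 2 + snd (center c) ^ 2 - radius c ^ 2)
              / power c ^ 2).
- fold (power c); field; assumption.
- unfold inv_x, inv_y, inv_r; field; assumption.
Qed.

Lemma inverse_inj (c d : circle) :
  0 < radius c -> 0 < radius d -> power c <> 0 -> power d <> 0 ->
  inv_x c = inv_x d -> inv_y c = inv_y d -> inv_r c ^ 2 = inv_r d ^ 2 -> c = d.
Proof.
intros rc rd wc wd Ex Ey Er.
assert (Ew : power c = power d).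
{ rewrite <- (Rinv_inv (power c)), <- (Rinv_inv (power d)).
  rewrite !power_inverse by assumption; now rewrite Ex, Ey, Er. }
unfold inv_x, inv_y, inv_r in *; rewrite Ew in Ex, Ey, Er; clear Ew wc.
destruct c as [[cx cy] r], d as [[dx dy] r'].
set (w := power (Circle (dx, dy) r')) in *; simpl in *.
assert (Ex' : cx = dx)
  by (apply (Rmult_eq_reg_r (/ w)); [exact Ex | now apply Rinv_neq_0_compat]).
assert (Ey' : cy = dy)
  by (apply (Rmult_eq_reg_r (/ w)); [exact Ey | now apply Rinv_neq_0_compat]).
assert (Er' : r = r').
{ assert (F : (r / w * w) ^ 2 = (r' / w * w) ^ 2)
    by (simpl; apply (f_equal (fun z => z * w ^ 2)) in Er; simpl in Er; lra).
  replace (r / w * w) with r in F by (field; assumption).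
  replace (r' / w * w) with r' in F by (field; assumption).
  nra. }
now subst.
Qed.

(** Dividing the tangency equation by the squares of both powers gives the
    tangency equation of the inverse circles. *)
Lemma tangent_inverse (c d : circle) :
  power c <> 0 -> power d <> 0 -> tangent c d ->
  ((inv_x c - inv_x d) ^ 2 + (inv_y c - inv_y d) ^ 2
     - inv_r c ^ 2 - inv_r d ^ 2) ^ 2
    = 4 * inv_r c ^ 2 * inv_r d ^ 2.
Proof.
intros wc wd [_ E].
assert (F : (inv_x c - inv_x d) ^ 2 + (inv_y c - inv_y d) ^ 2
              - inv_r c ^ 2 - inv_r d ^ 2
            = (sqdist (center c) (center d) - radius c ^ 2 - radius d ^ 2)
              / (power c * power d)).
{ replace ((inv_x c - inv_x d) ^ 2 + (inv_y c - inv_y d) ^ 2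
              - inv_r c ^ 2 - inv_r d ^ 2)
    with (/ power c + / power d - 2 * inv_x c * inv_x d - 2 * inv_y c * inv_y d)
    by (rewrite !power_inverse by assumption; ring).
  replace (sqdist (center c) (center d) - radius c ^ 2 - radius d ^ 2)
    with (power c + power d - 2 * fst (center c) * fst (center d)
          - 2 * snd (center c) * snd (center d)) by (unfold power, sqdist; ring).
  unfold inv_x, inv_y; field; now split. }
rewrite F.
replace (((sqdist (center c) (center d) - radius c ^ 2 - radius d ^ 2)
            / (power c * power d)) ^ 2)
  with ((sqdist (center c) (center d) - radius c ^ 2 - radius d ^ 2) ^ 2
        / (power c * power d) ^ 2) by (field; now split).
rewrite E; unfold inv_r; field; now split.
Qed.

Lemma half_abs_sqr (x : R) : (Rabs x / 2) ^ 2 = x ^ 2 / 4.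
Proof. rewrite <- (pow2_abs x); field. Qed.

Lemma tangent_axis_circle (c : circle) (p : R) :
  tangent c (axis_circle 0 p) ->
  (power c - p * fst (center c)) ^ 2 = (p * radius c) ^ 2.
Proof.
destruct 1 as [_ E].
replace ((p * radius c) ^ 2)
  with (4 * radius c ^ 2 * radius (axis_circle 0 p) ^ 2)
  by (simpl radius; rewrite half_abs_sqr; field).
rewrite <- E; f_equal; unfold power, sqdist, axis_circle; simpl center;
  simpl radius; simpl fst; simpl snd.
rewrite half_abs_sqr; field.
Qed.

(** The circle [axis_circle 0 p] inverts to the line of abscissa [/ p]; the
    inverse of a circle touching it has its center at distance [inv_r] from this
    line. *)
Lemma tangent_line (c : circle) (p : R) :
  p <> 0 -> power c <> 0 -> tangent c (axis_circle 0 p) ->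
  (/ p - inv_x c) ^ 2 = inv_r c ^ 2.
Proof.
intros p0 w0 T.
pose proof (tangent_axis_circle c p T) as F.
replace ((/ p - inv_x c) ^ 2)
  with ((power c - p * fst (center c)) ^ 2 / (p * power c) ^ 2)
  by (unfold inv_x; field; now split).
rewrite F; unfold inv_r; field; now split.
Qed.

(** The origin is then the only common point of the two circles, and it lies on
    the line of their centers, which is the first axis. *)
Lemma tangent_at_origin (c : circle) (p : R) :
  p <> 0 -> power c = 0 -> tangent c (axis_circle 0 p) ->
  snd (center c) = 0 /\ fst (center c) <> p / 2.
Proof.
intros p0 w0 T.
pose proof (tangent_axis_circle c p T) as F.
rewrite w0 in F.
assert (G : fst (center c) ^ 2 = radius c ^ 2).
{ apply (Rmult_eq_reg_l (p ^ 2)); [|now apply pow_nonzero].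
  replace (p ^ 2 * radius c ^ 2) with ((p * radius c) ^ 2) by ring.
  rewrite <- F; ring. }
unfold power in w0.
assert (y0 : snd (center c) = 0) by nra.
split; [exact y0|]; intros x0; destruct T as [neq _]; apply neq; simpl.
apply injective_projections; simpl; lra.
Qed.

(** The inverses of [axis_circle 0 p] and [axis_circle 0 q] bound a strip;
    circles touching both lines have their center on its middle line and its
    width as diameter. *)
Lemma strip_inverse (c : circle) (p q : R) :
  p <> 0 -> q <> 0 -> p <> q -> power c <> 0 ->
  tangent c (axis_circle 0 p) -> tangent c (axis_circle 0 q) ->
  inv_x c = (/ p + / q) / 2 /\ inv_r c ^ 2 = ((/ p - / q) / 2) ^ 2.
Proof.
intros p0 q0 pq w0 Tp Tq.
pose proof (tangent_line c p p0 w0 Tp) as Ep.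
pose proof (tangent_line c q q0 w0 Tq) as Eq.
assert (ab : / p - / q <> 0).
{ intros E; apply pq; rewrite <- (Rinv_inv p), <- (Rinv_inv q); f_equal; lra. }
assert (Ex : inv_x c = (/ p + / q) / 2).
{ apply (Rmult_eq_reg_l (/ p - / q)); [nra | assumption]. }
split; [exact Ex|].
rewrite <- Ep, Ex; field; now split.
Qed.

(** If [d] passed through the origin, it would invert to a line parallel to the
    strip and touching the inverse of [c], hence to one side of the strip. *)
Lemma power_neq0_step (c d : circle) (p q : R) :
  p <> 0 -> q <> 0 -> p <> q -> 0 < radius d -> power c <> 0 -> tangent c d ->
  tangent c (axis_circle 0 p) -> tangent c (axis_circle 0 q) ->
  tangent d (axis_circle 0 p) -> tangent d (axis_circle 0 q) ->
  power d <> 0.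
Proof.
intros p0 q0 pq rd wc Tcd Tcp Tcq Tdp Tdq wd.
destruct (tangent_at_origin d p p0 wd Tdp) as [yd xp].
destruct (tangent_at_origin d q q0 wd Tdq) as [_ xq].
destruct (strip_inverse c p q p0 q0 pq wc Tcp Tcq) as [Ex _].
pose proof (tangent_line c p p0 wc Tcp) as Ep.
set (x := fst (center d)) in *.
assert (rE : radius d ^ 2 = x ^ 2).
{ unfold power in wd; rewrite yd in wd; fold x in wd; lra. }
assert (x0 : x <> 0) by (intros E; rewrite E in rE; nra).
assert (Ed : d = axis_circle 0 (2 * x)).
{ destruct d as [[dx dy] r]; unfold axis_circle; simpl in *.
  subst x dy; f_equal; [f_equal; field|].
  replace (0 - 2 * dx) with (- (2 * dx)) by ring.
  rewrite Rabs_Ropp, Rabs_mult, (Rabs_pos_eq 2) by lra.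
  replace (2 * Rabs dx / 2) with (Rabs dx) by field.
  apply Rsqr_inj; [lra | apply Rabs_pos |].
  rewrite <- Rsqr_abs; unfold Rsqr; lra. }
rewrite Ed in Tcd.
assert (x20 : 2 * x <> 0) by lra.
pose proof (tangent_line c (2 * x) x20 wc Tcd) as Ed'.
assert (Z : (/ (2 * x) - / p) * (/ (2 * x) - / q) = 0) by nra.
apply Rmult_integral in Z; destruct Z as [Z|Z].
- apply xp; replace p with (2 * x); [field|].
  rewrite <- (Rinv_inv p), <- (Rinv_inv (2 * x)); f_equal; lra.
- apply xq; replace q with (2 * x); [field|].
  rewrite <- (Rinv_inv q), <- (Rinv_inv (2 * x)); f_equal; lra.
Qed.

(** The inverse circles have equal radii, so the tangency equation leaves two
    cases: centers one width apart, or equal centers; in the second case [c] and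
    [d] would coincide. *)
Lemma strip_step (c d : circle) (p q : R) :
  p <> 0 -> q <> 0 -> p <> q -> 0 < radius c -> 0 < radius d ->
  power c <> 0 -> power d <> 0 -> tangent c d ->
  tangent c (axis_circle 0 p) -> tangent c (axis_circle 0 q) ->
  tangent d (axis_circle 0 p) -> tangent d (axis_circle 0 q) ->
  (inv_y d - inv_y c) ^ 2 = (/ p - / q) ^ 2.
Proof.
intros p0 q0 pq rc rd wc wd Tcd Tcp Tcq Tdp Tdq.
destruct (strip_inverse c p q p0 q0 pq wc Tcp Tcq) as [Xc Rc].
destruct (strip_inverse d p q p0 q0 pq wd Tdp Tdq) as [Xd Rd].
pose proof (tangent_inverse c d wc wd Tcd) as E.
rewrite Xc, Xd, Rc, Rd in E.
set (h := / p - / q) in *; set (z := inv_y d - inv_y c).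
assert (F : z ^ 2 * (z ^ 2 - h ^ 2) = 0).
{ replace (inv_y c) with (inv_y d - z) in E by (unfold z; ring).
  match type of E with ?l = ?r => assert (G : l - r = 0) by lra end.
  rewrite <- G; field; now split. }
apply Rmult_integral in F; destruct F as [F|F]; [exfalso|lra].
assert (z0 : z = 0) by nra.
destruct Tcd as [neq _]; apply neq; f_equal.
apply inverse_inj; try assumption; try congruence.
unfold z in z0; lra.
Qed.

(** * The row of inverted circles *)

(** A change of direction would bring the walk back, after two steps of equal
    length, to the point where it was. *)
Lemma injective_walk (Y : Z -> R) (h : R) :
  Y 0%Z = 0 ->
  (forall n, (Y (n + 1)%Z - Y n) ^ 2 = h ^ 2) ->
  (forall m n, Y m = Y n -> m = n) ->
  exists s, s ^ 2 = h ^ 2 /\ forall n, Y n = IZR n * s.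
Proof.
intros Y0 step inj.
assert (same : forall n, Y (n + 1 + 1)%Z - Y (n + 1)%Z = Y (n + 1)%Z - Y n).
{ intros n; pose proof (step n) as S1; pose proof (step (n + 1)%Z) as S2.
  assert (neq : Y (n + 1 + 1)%Z - Y n <> 0).
  { intros E; apply Rminus_diag_uniq, inj in E; lia. }
  apply (Rmult_eq_reg_l (Y (n + 1 + 1)%Z - Y n)); [|assumption].
  apply Rminus_diag_uniq.
  transitivity ((Y (n + 1 + 1)%Z - Y (n + 1)%Z) ^ 2 - (Y (n + 1)%Z - Y n) ^ 2);
    [ring | lra]. }
exists (Y 1%Z); split.
{ rewrite <- (step 0%Z), Y0; simpl Z.add; ring. }
assert (const : forall n, Y (n + 1)%Z - Y n = Y 1%Z).
{ intros n; induction n as [|n IH|n IH] using Z.peano_ind.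
  - simpl Z.add; rewrite Y0; ring.
  - unfold Z.succ; now rewrite same.
  - pose proof (same (Z.pred n)) as S.
    replace (Z.pred n + 1)%Z with n in * by lia; lra. }
intros n; induction n as [|n IH|n IH] using Z.peano_ind.
- rewrite Y0; ring.
- unfold Z.succ; rewrite plus_IZR; pose proof (const n); lra.
- pose proof (const (Z.pred n)) as S.
  replace (Z.pred n + 1)%Z with n in S by lia.
  unfold Z.pred at 2; rewrite plus_IZR; lra.
Qed.

(** The chain is recovered from its inverse: a row of circles of diameter [|s|]
    along the middle line of the strip. No member passes through the origin,
    since [d 0] has power [p * q] and [power_neq0_step] propagates along the chain
    in both directions. *)
Lemma chain_inverse (p q : R) (d : Z -> circle) :
  p <> 0 -> q <> 0 -> p <> q ->
  d 0%Z = axis_circle p q ->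
  (forall n, 0 < radius (d n)) ->
  (forall m n, d m = d n -> m = n) ->
  (forall n, tangent (d n) (axis_circle 0 p)) ->
  (forall n, tangent (d n) (axis_circle 0 q)) ->
  (forall n, tangent (d n) (d (n + 1)%Z)) ->
  exists s, forall n,
    power (d n) <> 0 /\
    center (d n) = (power (d n) * ((/ p + / q) / 2), power (d n) * (IZR n * s)) /\
    (2 * radius (d n)) ^ 2 = (power (d n) * s) ^ 2.
Proof.
intros p0 q0 pq d0 rpos inj Tp Tq T.
assert (w : forall n, power (d n) <> 0).
{ intros n; induction n as [|n IH|n IH] using Z.peano_ind.
  - rewrite d0; unfold power, axis_circle; simpl center; simpl radius.
    rewrite half_abs_sqr; simpl fst; simpl snd.
    replace (((p + q) / 2) ^ 2 + 0 ^ 2 - (p - q) ^ 2 / 4) with (p * q)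
      by field.
    now apply Rmult_integral_contrapositive_currified.
  - now apply (power_neq0_step (d n) _ p q).
  - apply (power_neq0_step (d n) _ p q); auto.
    pose proof (T (Z.pred n)) as [neq E].
    replace (Z.pred n + 1)%Z with n in * by lia.
    split; [congruence|].
    unfold sqdist in *; nra. }
assert (S : forall n, inv_x (d n) = (/ p + / q) / 2 /\
                      inv_r (d n) ^ 2 = ((/ p - / q) / 2) ^ 2).
{ intros n; now apply strip_inverse. }
destruct (injective_walk (fun n => inv_y (d n)) (/ p - / q)) as [s [sE Ys]].
- rewrite d0; unfold inv_y; simpl; unfold Rdiv; ring.
- intros n; now apply strip_step.
- intros m n E; apply inj, inverse_inj; try apply w; try apply rpos;
    destruct (S m), (S n); congruence.
- exists s; intros n; split; [apply w|].
  destruct (S n) as [Ex Er]; split.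
  + rewrite <- Ex, <- Ys; unfold inv_x, inv_y.
    apply injective_projections; simpl; field; apply w.
  + rewrite (Rpow_mult_distr (power (d n))), sE.
    replace ((/ p - / q) ^ 2) with (4 * inv_r (d n) ^ 2) by (rewrite Er; field; auto).
    unfold inv_r; field; apply w.
Qed.

(** * The labelling *)

Lemma permutation3 (T : Type) (x y z a b c : T) :
  Permutation [x; y; z] [a; b; c] ->
  [x; y; z] = [a; b; c] \/ [x; y; z] = [a; c; b] \/
  [x; y; z] = [b; a; c] \/ [x; y; z] = [b; c; a] \/
  [x; y; z] = [c; a; b] \/ [x; y; z] = [c; b; a].
Proof.
intros H.
assert (xin : In x [a; b; c]).
{ apply (Permutation_in _ H); now left. }
destruct xin as [<-|[<-|[<-|[]]]].
- apply Permutation_cons_inv, Permutation_sym, Permutation_length_2_inv in H.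
  destruct H as [E|E]; injection E as -> ->; auto 10.
- apply (Permutation_cons_app_inv [a] [c]), Permutation_sym,
    Permutation_length_2_inv in H.
  destruct H as [E|E]; injection E as -> ->; auto 10.
- apply (Permutation_cons_app_inv [a; b] []), Permutation_sym,
    Permutation_length_2_inv in H.
  destruct H as [E|E]; injection E as -> ->; auto 10.
Qed.

Lemma circle_diam_sym (X Y : point) : circle_diam X Y = circle_diam Y X.
Proof.
unfold circle_diam; f_equal.
- unfold along; f_equal; field.
- unfold edist; now rewrite distance_symm.
Qed.

(** The three circles are those on the sides of the degenerate triangle
    [P1 P2 P3], whatever the labelling; removing [e2] and [e3] from this
    multiset leaves the circle on [P2 P3]. *)
Lemma third_circle (A B C P1 P2 P3 : point) (e1 e2 e3 : circle) :
  Permutation [e1; e2; e3] [circle_diam B C; circle_diam C A; circle_diam A B] ->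
  Permutation [P1; P2; P3] [A; B; C] ->
  e2 = circle_diam P3 P1 -> e3 = circle_diam P1 P2 ->
  e1 = circle_diam P2 P3.
Proof.
intros He HP -> ->.
assert (K : Permutation
              [circle_diam B C; circle_diam C A; circle_diam A B]
              [circle_diam P2 P3; circle_diam P3 P1; circle_diam P1 P2]).
{ apply permutation3 in HP.
  rewrite (circle_diam_sym C A).
  destruct HP as [E|[E|[E|[E|[E|E]]]]]; injection E as -> -> ->;
    rewrite ?(circle_diam_sym C B), ?(circle_diam_sym C A), ?(circle_diam_sym B A).
  - apply Permutation_refl.
  - apply perm_skip, perm_swap.
  - apply perm_swap.
  - eapply perm_trans; [apply perm_swap|]; apply perm_skip, perm_swap.
  - eapply perm_trans; [apply perm_skip, perm_swap|]; apply perm_swap.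
  - eapply perm_trans; [apply perm_swap|].
    eapply perm_trans; [apply perm_skip, perm_swap|]; apply perm_swap. }
pose proof (perm_trans He K) as L.
apply (Permutation_app_inv_r [circle_diam P3 P1; circle_diam P1 P2] [e1]
         [circle_diam P2 P3]) in L.
now apply Permutation_length_1 in L.
Qed.

(** The frame of the proof: origin [P1], first axis along [AB]. *)
Lemma labelled_frame (A B C P1 P2 P3 : point) :
  on_segment A B C -> C <> A -> C <> B ->
  Permutation [P1; P2; P3] [A; B; C] ->
  exists (u : point) (L p q : R),
    unit_vector u /\ L <> 0 /\
    fst B - fst A = L * fst u /\ snd B - snd A = L * snd u /\
    coords P1 u P2 = (p, 0) /\ coords P1 u P3 = (q, 0) /\
    p <> 0 /\ q <> 0 /\ p <> q.
Proof.
intros [t [_ EC]] CA CB HP.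
assert (AB : A <> B).
{ intros E; apply CA; rewrite EC, <- E; unfold along.
  apply injective_projections; simpl; ring. }
assert (Lpos : 0 < edist A B).
{ destruct (edist_ge0 A B) as [H|H]; [exact H|exfalso].
  apply AB, sqdist_eq0; rewrite <- edist_sqr, <- H; ring. }
set (L := edist A B) in *.
set (u := ((fst B - fst A) / L, (snd B - snd A) / L)).
assert (uE : unit_vector u).
{ unfold unit_vector, u; simpl fst; simpl snd.
  replace (((fst B - fst A) / L) ^ 2 + ((snd B - snd A) / L) ^ 2)
    with (sqdist A B / L ^ 2) by (unfold sqdist; field; lra).
  rewrite <- edist_sqr; fold L; field; lra. }
assert (Bx : fst B - fst A = L * fst u) by (unfold u; simpl; field; lra).
assert (By : snd B - snd A = L * snd u) by (unfold u; simpl; field; lra).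
clearbody u.
assert (on_axis : forall X, In X [P1; P2; P3] -> exists a, X = along A B a).
{ intros X inX; apply (Permutation_in X HP) in inX.
  destruct inX as [<-|[<-|[<-|[]]]]; [exists 0|exists 1|now exists t];
    apply injective_projections; simpl; ring. }
assert (nodup : NoDup [P1; P2; P3]).
{ apply (Permutation_NoDup (Permutation_sym HP)).
  repeat constructor; simpl; intuition congruence. }
destruct (on_axis P1) as [a1 E1]; [simpl; auto|].
destruct (on_axis P2) as [a2 E2]; [simpl; auto|].
destruct (on_axis P3) as [a3 E3]; [simpl; auto|].
assert (coordsE : forall a b, coords (along A B a) u (along A B b)
                              = ((b - a) * L, 0)).
{ intros a b; unfold coords, along; cbn [fst snd].
  rewrite Bx, By; apply injective_projections; cbn [fst snd].
  - transitivity ((b - a) * L * (fst u ^ 2 + snd u ^ 2)); [simpl; ring|].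
    rewrite uE; ring.
  - simpl; ring. }
assert (neq : forall a b, along A B a <> along A B b -> (b - a) * L <> 0).
{ intros a b H E; apply H; f_equal.
  apply Rmult_integral in E; lra. }
inversion nodup as [|? ? N1 N2]; inversion N2 as [|? ? N3 N4]; subst; simpl in *.
exists u, L, ((a2 - a1) * L), ((a3 - a1) * L).
assert (n12 : (a2 - a1) * L <> 0) by (apply neq; intuition congruence).
assert (n13 : (a3 - a1) * L <> 0) by (apply neq; intuition congruence).
assert (n23 : (a3 - a2) * L <> 0) by (apply neq; intuition congruence).
rewrite !coordsE; repeat split; try assumption; lra.
Qed.

(** * The distance formula *)

Theorem theorem1 :
  forall (A B C : point) (alpha beta gamma : circle)
    (e1 e2 e3 : circle) (P1 P2 P3 : point) (delta : Z -> circle),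
  on_segment A B C -> C <> A -> C <> B ->
  alpha = circle_diam B C ->
  beta = circle_diam C A ->
  gamma = circle_diam A B ->
  Permutation [e1; e2; e3] [alpha; beta; gamma] ->
  Permutation [P1; P2; P3] [A; B; C] ->
  e2 = circle_diam P3 P1 ->
  e3 = circle_diam P1 P2 ->
  chain e1 e2 e3 delta ->
  forall (i n : Z) (H : point),
  center (delta i) <> P1 ->
  unique (fun X : point => on_line P1 (center (delta i)) X /\
                           on_perp A B (center (delta n)) X) H ->
  edist (center (delta n)) H = 2 * IZR (Z.abs (n - i)) * radius (delta n).
Proof.
intros A B C alpha beta gamma e1 e2 e3 P1 P2 P3 delta segC CA CB -> -> ->
  He HP E2 E3 [d0 [rpos [inj [T23 T]]]] i n H neqP1 [[onH perpH] uniqH].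
pose proof (third_circle A B C P1 P2 P3 e1 e2 e3 He HP E2 E3) as E1.
destruct (labelled_frame A B C P1 P2 P3 segC CA CB HP)
  as (u & L & p & q & uE & L0 & Bx & By & C2 & C3 & p0 & q0 & pq).
assert (C1 : coords P1 u P1 = (0, 0)) by (unfold coords; f_equal; ring).
set (d := fun k => in_frame P1 u (delta k)).
assert (F1 : in_frame P1 u e1 = axis_circle p q)
  by (rewrite E1; now apply in_frame_circle_diam).
assert (F2 : in_frame P1 u e2 = axis_circle 0 q).
{ rewrite E2, circle_diam_sym; now apply in_frame_circle_diam. }
assert (F3 : in_frame P1 u e3 = axis_circle 0 p)
  by (rewrite E3; now apply in_frame_circle_diam).
assert (r2 : 0 < radius e2).
{ change (0 < radius (in_frame P1 u e2)); rewrite F2; simpl.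
  pose proof (Rabs_pos_lt (0 - q)); lra. }
assert (r3 : 0 < radius e3).
{ change (0 < radius (in_frame P1 u e3)); rewrite F3; simpl.
  pose proof (Rabs_pos_lt (0 - p)); lra. }
destruct (chain_inverse p q d) as [s dE]; try assumption.
- unfold d; now rewrite d0.
- intros k l E; now apply inj, (in_frame_inj P1 u).
- intros k; rewrite <- F3; apply tangent_in_frame, touch_tangent; auto; apply T23.
- intros k; rewrite <- F2; apply tangent_in_frame, touch_tangent; auto; apply T23.
- intros k; apply tangent_in_frame, touch_tangent; auto.
- destruct (dE i) as [wi [Ci _]]; destruct (dE n) as [wn [Cn Rn]].
  set (m := (/ p + / q) / 2) in *.
  change (center (d i)) with (coords P1 u (center (delta i))) in Ci.
  change (center (d n)) with (coords P1 u (center (delta n))) in Cn.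
  change (radius (d n)) with (radius (delta n)) in Rn.
  set (vi := power (d i)) in *; set (vn := power (d n)) in *.
  assert (perp : forall X, on_perp A B (center (delta n)) X <->
                 fst (coords P1 u X) = vn * m).
  { intros X; replace (vn * m) with (fst (coords P1 u (center (delta n))))
      by now rewrite Cn.
    unfold on_perp; rewrite Bx, By; unfold coords; simpl; split; intros E.
    - apply (Rmult_eq_reg_l L); [lra | assumption].
    - apply (f_equal (Rmult L)) in E; lra. }
  assert (m0 : m <> 0).
  { (* For [m = 0] the line [P1 D_i] is the perpendicular itself, so that their
       common point is not unique. *)
    intros m0; apply neqP1.
    assert (all : forall t, H = along P1 (center (delta i)) t).
    { intros t; apply uniqH; split; [now exists t|].
      apply perp; rewrite coords_along, Ci, m0; simpl; ring. }
    transitivity H; [rewrite (all 1)|rewrite (all 0)];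
      apply injective_projections; simpl; ring. }
  destruct onH as [t Ht]; apply perp in perpH.
  rewrite Ht, coords_along, Ci in perpH; simpl in perpH.
  assert (tE : t * vi = vn) by (apply (Rmult_eq_reg_r m); [lra | assumption]).
  apply Rsqr_inj.
  + apply edist_ge0.
  + apply Rmult_le_pos; [|now apply Rlt_le, rpos].
    apply Rmult_le_pos; [lra | apply IZR_le, Z.abs_nonneg].
  + rewrite !Rsqr_pow2, edist_sqr, <- (sqdist_coords P1 u) by assumption.
    rewrite Cn, Ht, coords_along, Ci; unfold sqdist; simpl fst; simpl snd.
    rewrite abs_IZR.
    replace ((2 * Rabs (IZR (n - i)) * radius (delta n)) ^ 2)
      with (Rabs (IZR (n - i)) ^ 2 * (2 * radius (delta n)) ^ 2) by ring.
    rewrite pow2_abs, Rn, minus_IZR, <- tE; ring.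
Qed.
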